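(* Let $f$ be a complex-valued function such that $f(z)$ is analytic for $|z|<1$, $|f(z)|<1$ for $|z|<1$, and $f(0)=0$. Then $$|f(z)| \leq |z|\, \frac{|z|+|f'(0)|}{1+|f'(0)||z|} \qquad\text{for all } |z|<1.$$ *)

(* Defs.v *)
From Stdlib Require Export Reals.
From Coquelicot Require Export Coquelicot.

(* [ex_derive] is taken over the field [C_AbsRing], so this is complex (not
   real) differentiability, throughout a neighbourhood of [z]. *)
Definition analytic_at (f : C -> C) (z : C) : Prop :=
  @locally C_NormedModule z
    (fun w => @ex_derive C_AbsRing C_NormedModule f w).

(* Main.v *)
Require Import Defs.
From Stdlib Require Import Reals Lra Psatz ClassicalEpsilon List.
From Coquelicot Require Import Coquelicot.
Open Scope R_scope.

(** The quotient [g z = f z / z] extends continuously to [0] by [f' 0], and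
    [|g| <= 1] by the maximum principle. Schwarz-Pick for [g] gives
    [|g z - g 0| <= |z| |1 - conj (g 0) g z|], which implies the bound
    on [|g z|]. The derivative of [f] is not assumed continuous, so everything
    rests on Goursat's bisection argument: in polar coordinates it shows that
    the mean of [Re F] over a circle is [Re F] at the centre, for [F] continuous
    at the centre and differentiable around it. This yields a maximum principle
    for continuous functions that are differentiable off a finite set, hence no
    theorem on removable singularities is needed. *)

(** * Bisection of rectangles and Goursat's argument *)

(** If [P] fails for the whole rectangle, it fails for one of the four quarters, and so on; the
    nested bad rectangles shrink to a point [(p, q)], where the local hypothesis contradicts
    badness. All rectangles are similar to the first, so a corner and a scale [s] describe each of
    them. The principle serves both Goursat's argument and, as a form of compactness, the existence
    of maxima. *)
Lemma rectangle_bisection (P : R -> R -> R -> Prop) (a b A B : R)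
  (inside := fun x y s =>
     (a <= x /\ x + s * A <= a + A) /\ (b <= y /\ y + s * B <= b + B)) :
  0 <= A -> 0 <= B ->
  (forall x y s, 0 < s -> inside x y s ->
     P x y (s / 2) -> P (x + s / 2 * A) y (s / 2) ->
     P x (y + s / 2 * B) (s / 2) ->
     P (x + s / 2 * A) (y + s / 2 * B) (s / 2) -> P x y s) ->
  (forall p q, a <= p <= a + A -> b <= q <= b + B ->
     exists d : posreal, forall x y s, 0 < s < d -> inside x y s ->
       x <= p <= x + s * A -> y <= q <= y + s * B -> P x y s) ->
  P a b 1.
Proof.
intros HA HB Hsplit Hloc.
destruct (classic (P a b 1)) as [H1|H1]; [exact H1|exfalso].
set (bad := fun x y s => 0 < s /\ inside x y s /\ ~ P x y s).
(* Badness is a premise under the existential quantifier, so that choice yields a total function;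
   [(0, 0)] is a dummy value for rectangles that are not bad. *)
assert (Hstep : forall xy : R * R, forall s, exists xy' : R * R,
  bad (fst xy) (snd xy) s ->
  bad (fst xy') (snd xy') (s / 2) /\
  (fst xy <= fst xy' /\ fst xy' + s / 2 * A <= fst xy + s * A) /\
  (snd xy <= snd xy' /\ snd xy' + s / 2 * B <= snd xy + s * B)).
{ intros [x y] s; simpl.
  destruct (classic (bad x y s)) as [[Hs [Hin Hbad]]|Hg];
    [|exists (0, 0); tauto].
  assert (HsA : 0 <= s / 2 * A) by (apply Rmult_le_pos; lra).
  assert (HsB : 0 <= s / 2 * B) by (apply Rmult_le_pos; lra).
  assert (EA : s * A = s / 2 * A + s / 2 * A) by field.
  assert (EB : s * B = s / 2 * B + s / 2 * B) by field.
  destruct (classic (P x y (s / 2))) as [P1|P1];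
  [destruct (classic (P (x + s / 2 * A) y (s / 2))) as [P2|P2];
  [destruct (classic (P x (y + s / 2 * B) (s / 2))) as [P3|P3];
  [destruct (classic (P (x + s / 2 * A) (y + s / 2 * B) (s / 2))) as [P4|P4]|]|]|].
  - elim Hbad; auto.
  - exists (x + s / 2 * A, y + s / 2 * B); intros _; unfold bad, inside in *; simpl;
      repeat split; try assumption; lra.
  - exists (x, y + s / 2 * B); intros _; unfold bad, inside in *; simpl;
      repeat split; try assumption; lra.
  - exists (x + s / 2 * A, y); intros _; unfold bad, inside in *; simpl;
      repeat split; try assumption; lra.
  - exists (x, y); intros _; unfold bad, inside in *; simpl;
      repeat split; try assumption; lra. }
set (next := fun xy s => proj1_sig (constructive_indefinite_description _ (Hstep xy s))).
set (w := fix w n := match n with O => (a, b) | S m => next (w m) ((/ 2) ^ m) end).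
set (X := fun n => fst (w n)). set (Y := fun n => snd (w n)).
assert (Hw : forall n, bad (X n) (Y n) ((/ 2) ^ n)).
{ induction n as [|n IH].
  - unfold bad, inside, X, Y; simpl; repeat split; try assumption; lra.
  - unfold X, Y; simpl; unfold next.
    destruct (constructive_indefinite_description _ (Hstep (w n) ((/ 2) ^ n))) as [xy' H].
    simpl. destruct (H IH) as [H' _].
    replace (/ 2 * (/ 2) ^ n) with ((/ 2) ^ n / 2) by field. exact H'. }
assert (Hn : forall n, (X n <= X (S n) /\
      X (S n) + (/ 2) ^ (S n) * A <= X n + (/ 2) ^ n * A) /\
      (Y n <= Y (S n) /\ Y (S n) + (/ 2) ^ (S n) * B <= Y n + (/ 2) ^ n * B)).
{ intros n. unfold X, Y; simpl; unfold next.
  destruct (constructive_indefinite_description _ (Hstep (w n) ((/ 2) ^ n))) as [xy' H].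
  simpl. destruct (H (Hw n)) as [_ H'].
  replace (/ 2 * (/ 2) ^ n) with ((/ 2) ^ n / 2) by field. exact H'. }
clearbody X Y. clear w next Hstep.
(* Nested intervals: every left end is below every right end, so the supremum of the left ends lies
   in all of them. *)
assert (Hlim : forall (Z : nat -> R) (D : R), 0 <= D ->
  (forall n, Z n <= Z (S n) /\ Z (S n) + (/ 2) ^ (S n) * D <= Z n + (/ 2) ^ n * D) ->
  exists p, forall n, Z n <= p <= Z n + (/ 2) ^ n * D).
{ intros Z D HD HZ.
  assert (Hm : forall n k, Z n <= Z (n + k)%nat /\
     Z (n + k)%nat + (/ 2) ^ (n + k) * D <= Z n + (/ 2) ^ n * D).
  { intros n; induction k as [|k IH].
    - rewrite Nat.add_0_r; lra.
    - rewrite Nat.add_succ_r. specialize (HZ (n + k)%nat). lra. }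
  assert (Hpos : forall n, 0 <= (/ 2) ^ n * D).
  { intros n; apply Rmult_le_pos; [apply pow_le; lra|exact HD]. }
  assert (Hub : forall n m, Z m <= Z n + (/ 2) ^ n * D).
  { intros n m. destruct (Hm m n) as [H2 _]. destruct (Hm n m) as [_ H3].
    rewrite Nat.add_comm in H2. specialize (Hpos (n + m)%nat). lra. }
  destruct (completeness (fun r => exists n, r = Z n)) as [p [Hp1 Hp2]].
  - exists (Z O + (/ 2) ^ 0 * D). intros r [n ->]. apply Hub.
  - exists (Z O), O; reflexivity.
  - exists p. intros n. split.
    + apply Hp1; exists n; reflexivity.
    + apply Hp2. intros r [m ->]. apply Hub. }
destruct (Hlim X A HA (fun n => proj1 (Hn n))) as [p Hp].
destruct (Hlim Y B HB (fun n => proj2 (Hn n))) as [q Hq].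
assert (Hin0 := Hw O). destruct Hin0 as [_ [[H2 H3] _]].
assert (Hp0 := Hp O). assert (Hq0 := Hq O). simpl in *.
destruct (Hloc p q) as [d Hd]; [lra|lra|].
destruct (pow_lt_1_zero (/ 2)) with (y := pos d) as [N HN];
  [rewrite Rabs_pos_eq; lra|apply cond_pos|].
specialize (HN N (Nat.le_refl N)).
destruct (Hw N) as [Hs [Hi Hb]].
apply Hb, Hd; auto.
split; [exact Hs|]. rewrite Rabs_pos_eq in HN; lra.
Qed.

Lemma RInt_near_const (f : R -> R) (c e x1 x2 : R) : x1 <= x2 -> ex_RInt f x1 x2 ->
  (forall t, x1 <= t <= x2 -> Rabs (f t - c) <= e) ->
  Rabs (RInt f x1 x2 - c * (x2 - x1)) <= (x2 - x1) * e.
Proof.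
intros Hx Hf He.
assert (Hc : ex_RInt (fun _ : R => c) x1 x2) by apply (ex_RInt_const (V := R_NormedModule)).
replace (RInt f x1 x2 - c * (x2 - x1)) with (RInt (fun t => f t - c) x1 x2).
- apply abs_RInt_le_const; auto.
  apply (ex_RInt_minus (V := R_NormedModule)); auto.
- rewrite (RInt_minus (V := R_CompleteNormedModule) f (fun _ => c)); auto.
  rewrite (RInt_const (V := R_CompleteNormedModule)).
  unfold minus, plus, opp, scal; simpl. unfold mult; simpl. ring.
Qed.

(** The outward flux of the field [(u, -v)] through the boundary of the rectangle, or the
    counterclockwise integral of [v dx + u dy]. Its divergence is [u_x - v_y]. *)
Definition flux (u v : R -> R -> R) (x1 x2 y1 y2 : R) : R :=
  RInt (fun y => u x2 y - u x1 y) y1 y2 - RInt (fun x => v x y2 - v x y1) x1 x2.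

Lemma continuity_2d_pt_continuous_l (f : R -> R -> R) (x y : R) :
  continuity_2d_pt f x y -> continuous (fun t => f t y) x.
Proof.
intros H. apply (proj2 (filterlim_locally (F := locally x) _ _)). intros eps.
exact (locally_2d_1d_const_y _ x y (H eps)).
Qed.

Lemma continuity_2d_pt_continuous_r (f : R -> R -> R) (x y : R) :
  continuity_2d_pt f x y -> continuous (fun t => f x t) y.
Proof.
intros H. apply (proj2 (filterlim_locally (F := locally y) _ _)). intros eps.
exact (locally_2d_1d_const_x _ x y (H eps)).
Qed.

Section Goursat.

Variables (u v : R -> R -> R) (a A b B : R).
Hypotheses (HA : 0 < A) (HB : 0 < B).
Hypothesis Hdiff : forall x y, a <= x <= a + A -> b <= y <= b + B ->
  exists l k m, differentiable_pt_lim u x y l k /\ differentiable_pt_lim v x y m l.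

Let u_cont x y : a <= x <= a + A -> b <= y <= b + B -> continuity_2d_pt u x y.
Proof.
intros Hx Hy. destruct (Hdiff x y Hx Hy) as [l [k [m [H _]]]].
apply differentiable_continuity_pt. exists l, k. exact H.
Qed.

Let v_cont x y : a <= x <= a + A -> b <= y <= b + B -> continuity_2d_pt v x y.
Proof.
intros Hx Hy. destruct (Hdiff x y Hx Hy) as [l [k [m [_ H]]]].
apply differentiable_continuity_pt. exists m, l. exact H.
Qed.

Let ex_u x y1 y2 : a <= x <= a + A -> b <= y1 <= y2 -> y2 <= b + B ->
  ex_RInt (fun y => u x y) y1 y2.
Proof.
intros Hx H1 H2. apply (ex_RInt_continuous (V := R_CompleteNormedModule)).
intros z Hz. rewrite Rmin_left, Rmax_right in Hz by lra.
apply continuity_2d_pt_continuous_r, u_cont; lra.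
Qed.

Let ex_v y x1 x2 : b <= y <= b + B -> a <= x1 <= x2 -> x2 <= a + A ->
  ex_RInt (fun x => v x y) x1 x2.
Proof.
intros Hx H1 H2. apply (ex_RInt_continuous (V := R_CompleteNormedModule)).
intros z Hz. rewrite Rmin_left, Rmax_right in Hz by lra.
apply (continuity_2d_pt_continuous_l v z y), v_cont; lra.
Qed.

Let flux_eq x1 x2 y1 y2 : a <= x1 <= x2 -> x2 <= a + A -> b <= y1 <= y2 -> y2 <= b + B ->
  flux u v x1 x2 y1 y2 =
  RInt (fun y => u x2 y) y1 y2 - RInt (fun y => u x1 y) y1 y2
  - (RInt (fun x => v x y2) x1 x2 - RInt (fun x => v x y1) x1 x2).
Proof.
intros Hx1 Hx2 Hy1 Hy2. unfold flux.
rewrite (RInt_minus (V := R_CompleteNormedModule) (fun y => u x2 y) (fun y => u x1 y)),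
  (RInt_minus (V := R_CompleteNormedModule) (fun x => v x y2) (fun x => v x y1));
  [reflexivity|apply ex_v; lra|apply ex_v; lra|apply ex_u; lra|apply ex_u; lra].
Qed.

(** Each inner edge belongs to two of the small rectangles, with opposite signs, and cancels. *)
Let flux_split x1 xm x2 y1 ym y2 : a <= x1 <= xm -> xm <= x2 <= a + A ->
  b <= y1 <= ym -> ym <= y2 <= b + B ->
  flux u v x1 x2 y1 y2 =
  flux u v x1 xm y1 ym + flux u v xm x2 y1 ym
  + flux u v x1 xm ym y2 + flux u v xm x2 ym y2.
Proof.
intros Hx1 Hx2 Hy1 Hy2. rewrite !flux_eq by lra.
assert (Eu : forall x, a <= x <= a + A -> RInt (fun y => u x y) y1 y2 =
   RInt (fun y => u x y) y1 ym + RInt (fun y => u x y) ym y2).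
{ intros x Hx. symmetry.
  apply (RInt_Chasles (V := R_CompleteNormedModule)); apply ex_u; lra. }
assert (Ev : forall y, b <= y <= b + B -> RInt (fun x => v x y) x1 x2 =
   RInt (fun x => v x y) x1 xm + RInt (fun x => v x y) xm x2).
{ intros y Hy. symmetry.
  apply (RInt_Chasles (V := R_CompleteNormedModule)); apply ex_v; lra. }
rewrite !Eu, !Ev by lra. ring.
Qed.

(** The linear parts of [u] and [v] at [(p, q)] contribute [l * (s * A) * (s * B)] to both
    integrals, and these cancel because [u_x = v_y = l]. What remains is a small multiple of [s]
    integrated along sides of length proportional to [s]. *)
Let flux_small p q : a <= p <= a + A -> b <= q <= b + B -> forall eps : posreal,
  exists d : posreal, forall x y s, 0 < s < d ->
    (a <= x /\ x + s * A <= a + A) /\ (b <= y /\ y + s * B <= b + B) ->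
    x <= p <= x + s * A -> y <= q <= y + s * B ->
    Rabs (flux u v x (x + s * A) y (y + s * B)) <= eps * (s * s).
Proof.
intros Hp Hq eps.
destruct (Hdiff p q Hp Hq) as [l [k [m [Hu Hv]]]].
set (S := A + B). assert (HS : 0 < S) by (unfold S; lra).
(* With tolerance [e] the two integrals err together by at most [2 * e * (s * S) * (s * S)], which
   for this value is half of the bound wanted. *)
assert (He : 0 < eps / (4 * S * S)).
{ apply Rdiv_lt_0_compat; [apply cond_pos|nra]. }
destruct (Hu (mkposreal _ He)) as [d1 H1].
destruct (Hv (mkposreal _ He)) as [d2 H2]. simpl in H1, H2.
set (e := eps / (4 * S * S)) in *.
assert (Hd : 0 < Rmin d1 d2 / S).
{ apply Rdiv_lt_0_compat; auto. apply Rmin_pos; apply cond_pos. }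
exists (mkposreal _ Hd). simpl. intros x y s [Hs Hsd] Hin Hx Hy.
assert (HsS : s * S < Rmin d1 d2).
{ apply (Rmult_lt_compat_r S) in Hsd; auto.
  unfold Rdiv in Hsd. rewrite Rmult_assoc, Rinv_l in Hsd; lra. }
assert (Hsd1 := Rmin_l d1 d2). assert (Hsd2 := Rmin_r d1 d2).
assert (HsA : 0 < s * A) by (apply Rmult_lt_0_compat; lra).
assert (HsB : 0 < s * B) by (apply Rmult_lt_0_compat; lra).
assert (ES : s * S = s * A + s * B) by (unfold S; ring).
assert (Hmax : forall x' y', x <= x' <= x + s * A -> y <= y' <= y + s * B ->
   Rabs (x' - p) <= s * A /\ Rabs (y' - q) <= s * B).
{ intros x' y' Hx' Hy'. split; apply Rabs_le; lra. }
assert (Bu : forall x' y', x <= x' <= x + s * A -> y <= y' <= y + s * B ->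
   Rabs (u x' y' - u p q - (l * (x' - p) + k * (y' - q))) <= e * (s * S)).
{ intros x' y' Hx' Hy'. destruct (Hmax x' y' Hx' Hy') as [G1 G2].
  eapply Rle_trans; [apply H1; lra|].
  apply Rmult_le_compat_l; [lra|]. apply Rmax_lub; lra. }
assert (Bv : forall x' y', x <= x' <= x + s * A -> y <= y' <= y + s * B ->
   Rabs (v x' y' - v p q - (m * (x' - p) + l * (y' - q))) <= e * (s * S)).
{ intros x' y' Hx' Hy'. destruct (Hmax x' y' Hx' Hy') as [G1 G2].
  eapply Rle_trans; [apply H2; lra|].
  apply Rmult_le_compat_l; [lra|]. apply Rmax_lub; lra. }
assert (I1 : Rabs (RInt (fun t => u (x + s * A) t - u x t) y (y + s * B)
   - (l * (s * A)) * (y + s * B - y)) <= (y + s * B - y) * (2 * (e * (s * S)))).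
{ apply RInt_near_const; [lra| |].
  - apply (ex_RInt_minus (V := R_NormedModule)); apply ex_u; lra.
  - intros t Ht.
    assert (K1 := Bu (x + s * A) t ltac:(lra) Ht). assert (K2 := Bu x t ltac:(lra) Ht).
    apply Rabs_le_between in K1. apply Rabs_le_between in K2. apply Rabs_le. lra. }
assert (I2 : Rabs (RInt (fun t => v t (y + s * B) - v t y) x (x + s * A)
   - (l * (s * B)) * (x + s * A - x)) <= (x + s * A - x) * (2 * (e * (s * S)))).
{ apply RInt_near_const; [lra| |].
  - apply (ex_RInt_minus (V := R_NormedModule)); apply ex_v; lra.
  - intros t Ht.
    assert (K1 := Bv t (y + s * B) Ht ltac:(lra)). assert (K2 := Bv t y Ht ltac:(lra)).
    apply Rabs_le_between in K1. apply Rabs_le_between in K2. apply Rabs_le. lra. }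
unfold flux.
apply Rabs_le_between in I1. apply Rabs_le_between in I2.
assert (Ee : e * (s * S) * (s * S) * 4 = eps * (s * s)) by (unfold e; field; lra).
assert (Hpos : 0 <= e * (s * S) * (s * S)).
{ apply Rmult_le_pos; [apply Rmult_le_pos|]; nra. }
apply Rabs_le. nra.
Qed.

(** The estimate [|flux| <= eps * s^2] passes from the four quarters to the whole, since
    [4 * (s / 2)^2 = s^2], and it holds near each point. Bisection gives it at scale 1, which is
    absurd when [eps] is half of a nonzero [|flux|]. *)
Lemma green_rectangle :
  RInt (fun y => u (a + A) y - u a y) b (b + B) =
  RInt (fun x => v x (b + B) - v x b) a (a + A).
Proof.
enough (H : flux u v a (a + A) b (b + B) = 0) by (unfold flux in H; lra).
destruct (Req_dec (flux u v a (a + A) b (b + B)) 0) as [H|H]; [exact H|exfalso].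
apply Rabs_pos_lt in H.
assert (He : 0 < Rabs (flux u v a (a + A) b (b + B)) / 2) by lra.
set (eps := mkposreal _ He).
assert (K := rectangle_bisection
  (fun x y s => Rabs (flux u v x (x + s * A) y (y + s * B)) <= eps * (s * s)) a b A B).
simpl in K. cut (Rabs (flux u v a (a + 1 * A) b (b + 1 * B)) <= eps * (1 * 1)).
{ rewrite !Rmult_1_l. simpl. lra. }
apply K; [lra|lra| |].
- clear K. intros x y s Hs [[Hx1 Hx2] [Hy1 Hy2]] P1 P2 P3 P4.
  assert (HsA : 0 < s / 2 * A) by (apply Rmult_lt_0_compat; lra).
  assert (HsB : 0 < s / 2 * B) by (apply Rmult_lt_0_compat; lra).
  assert (EA : x + s / 2 * A + s / 2 * A = x + s * A) by field.
  assert (EB : y + s / 2 * B + s / 2 * B = y + s * B) by field.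
  rewrite EA in P2, P4. rewrite EB in P3, P4.
  rewrite (flux_split x (x + s / 2 * A) (x + s * A) y (y + s / 2 * B) (y + s * B)) by lra.
  apply Rabs_le_between in P1. apply Rabs_le_between in P2.
  apply Rabs_le_between in P3. apply Rabs_le_between in P4.
  apply Rabs_le. lra.
- intros p q Hp Hq. exact (flux_small p q Hp Hq eps).
Qed.

End Goursat.

(** * Continuity and differentiability over C *)

(** The uniform structure is given explicitly: its balls are discs for [Cmod], whereas C as a
    product of two copies of R has squares for balls. *)
Notation Ccont := (@continuous (AbsRing_UniformSpace C_AbsRing) (AbsRing_UniformSpace C_AbsRing)).

Lemma Ccont_eps (F : C -> C) (z : C) :
  Ccont F z <-> forall eps : posreal, exists d : posreal, forall w,
    Cmod (w - z) < d -> Cmod (F w - F z) < eps.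
Proof.
exact (filterlim_locally (U := AbsRing_UniformSpace C_AbsRing)
  (F := @locally (AbsRing_UniformSpace C_AbsRing) z) F (F z)).
Qed.

Lemma Ccont_plus (F G : C -> C) (z : C) :
  Ccont F z -> Ccont G z -> Ccont (fun w => F w + G w)%C z.
Proof. exact (continuous_plus (U := AbsRing_UniformSpace C_AbsRing) (V := AbsRing_NormedModule C_AbsRing) F G z). Qed.

Lemma Ccont_mult (F G : C -> C) (z : C) :
  Ccont F z -> Ccont G z -> Ccont (fun w => F w * G w)%C z.
Proof. exact (continuous_mult (U := AbsRing_UniformSpace C_AbsRing) (K := C_AbsRing) F G z). Qed.

Lemma Ccont_const (c z : C) : Ccont (fun _ => c) z.
Proof. apply continuous_const. Qed.

Lemma Ccont_id (z : C) : Ccont (fun w => w) z.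
Proof. apply continuous_id. Qed.

Lemma Ccont_inv (F : C -> C) (z : C) :
  Ccont F z -> F z <> 0 -> Ccont (fun w => / F w)%C z.
Proof.
intros HF Hz. apply Ccont_eps. intros eps.
assert (Hm : 0 < Cmod (F z)) by now apply Cmod_gt_0.
set (m := Cmod (F z)) in *.
(* The first bound keeps [Cmod (F w)] above [m / 2]; the second then controls the quotient
   [|F w - F z| / (|F w| * m)]. *)
assert (He : 0 < Rmin (m / 2) (eps * (m * m) / 2)).
{ apply Rmin_pos; [lra|]. assert (0 < eps * (m * m)) by (apply Rmult_lt_0_compat; [apply cond_pos|nra]). lra. }
destruct (proj1 (Ccont_eps F z) HF (mkposreal _ He)) as [d Hd].
exists d. intros w Hw. specialize (Hd w Hw). simpl in Hd.
assert (H1 := Rmin_l (m / 2) (eps * (m * m) / 2)).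
assert (H2 := Rmin_r (m / 2) (eps * (m * m) / 2)).
assert (Hmw : m / 2 < Cmod (F w)).
{ assert (T := Cmod_triangle (F w) (- (F w - F z))).
  rewrite Cmod_opp in T. replace (F w + - (F w - F z))%C with (F z) in T by ring.
  fold m in T. lra. }
assert (Hw0 : F w <> 0) by (apply Cmod_gt_0; lra).
replace (/ F w - / F z)%C with (- (F w - F z) / (F w * F z))%C by (field; auto).
rewrite Cmod_div by now apply Cmult_neq_0.
rewrite Cmod_opp, Cmod_mult. fold m.
apply Rlt_div_l; [nra|].
apply Rlt_le_trans with (1 := Hd). apply Rle_trans with (1 := H2).
assert (Hep := cond_pos eps).
replace (eps * (m * m) / 2) with (eps * (m / 2 * m)) by field.
apply Rmult_le_compat_l; [lra|]. nra.
Qed.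

Lemma Ccont_ext_loc (F G : C -> C) (z : C) (d : posreal) :
  (forall w, Cmod (w - z) < d -> F w = G w) -> Ccont F z -> Ccont G z.
Proof.
intros H HF. eapply continuous_ext_loc; [|exact HF].
exists d. intros y Hy. first [exact (H y Hy)|symmetry; exact (H y Hy)].
Qed.

(* Caratheodory's form of complex differentiability: the factor [phi] for a zero
   of [F] is at the same time the quotient [F w / (w - z)], continuous at [z]. *)
Definition Cdiff (F : C -> C) (z : C) : Prop :=
  exists phi : C -> C, Ccont phi z /\ forall w, F w = (F z + phi w * (w - z))%C.

Lemma Cdiff_cont (F : C -> C) (z : C) : Cdiff F z -> Ccont F z.
Proof.
intros [phi [Hc H]].
apply (Ccont_ext_loc (fun w => F z + phi w * (w + - z))%C F z (mkposreal 1 Rlt_0_1)).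
{ intros w _. symmetry. exact (H w). }
apply Ccont_plus; [apply Ccont_const|].
apply Ccont_mult; [exact Hc|]. apply Ccont_plus; [apply Ccont_id|apply Ccont_const].
Qed.

(** [Cdiff] asks for a factor on the whole plane. The difference quotient, completed by [phi z] at
    [z], is one, and it coincides with [phi] near [z]. *)
Lemma Cdiff_intro (F phi : C -> C) (z : C) (d : posreal) : Ccont phi z ->
  (forall w, Cmod (w - z) < d -> F w = (F z + phi w * (w - z))%C) -> Cdiff F z.
Proof.
intros Hc HF.
exists (fun w => if Ceq_dec w z then phi z else (F w - F z) / (w - z))%C. split.
- apply (Ccont_ext_loc phi _ z d); [|exact Hc].
  intros w Hw. destruct (Ceq_dec w z) as [->|Hn]; [reflexivity|].
  rewrite (HF w Hw). field. now apply Cminus_eq_contra.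
- intros w. destruct (Ceq_dec w z) as [->|Hn]; [ring|].
  field. now apply Cminus_eq_contra.
Qed.

Lemma Cdiff_ext_loc (F G : C -> C) (z : C) (d : posreal) :
  (forall w, Cmod (w - z) < d -> F w = G w) -> Cdiff F z -> Cdiff G z.
Proof.
intros H [phi [Hc HF]]. apply (Cdiff_intro G phi z d Hc). intros w Hw.
rewrite <- (H w Hw), <- (H z); [apply HF|].
replace (z - z)%C with (RtoC 0) by ring. rewrite Cmod_0. apply cond_pos.
Qed.

Lemma Cdiff_const (c z : C) : Cdiff (fun _ => c) z.
Proof. exists (fun _ => RtoC 0). split; [apply Ccont_const|intros; ring]. Qed.

Lemma Cdiff_id (z : C) : Cdiff (fun w => w) z.
Proof. exists (fun _ => RtoC 1). split; [apply Ccont_const|intros; ring]. Qed.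

Lemma Cdiff_plus (F G : C -> C) (z : C) :
  Cdiff F z -> Cdiff G z -> Cdiff (fun w => F w + G w)%C z.
Proof.
intros [p [Hp HF]] [q [Hq HG]]. exists (fun w => p w + q w)%C.
split; [now apply Ccont_plus|]. intros w. rewrite (HF w), (HG w). ring.
Qed.

Lemma Cdiff_mult (F G : C -> C) (z : C) :
  Cdiff F z -> Cdiff G z -> Cdiff (fun w => F w * G w)%C z.
Proof.
intros DF DG. assert (CG := Cdiff_cont G z DG).
destruct DF as [p [Hp HF]], DG as [q [Hq HG]]. exists (fun w => p w * G w + F z * q w)%C. split.
- apply Ccont_plus; apply Ccont_mult; auto. apply Ccont_const.
- intros w. rewrite (HF w). replace (G z) with (G w - q w * (w - z))%C by (rewrite (HG w); ring). ring.
Qed.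

Lemma Cdiff_inv (F : C -> C) (z : C) : F z <> 0 ->
  Cdiff F z -> Cdiff (fun w => / F w)%C z.
Proof.
intros Hz DF. assert (CF := Cdiff_cont F z DF).
destruct DF as [p [Hp HF]].
(* The tolerance [Cmod (F z)] keeps [F w] away from 0. *)
destruct (proj1 (Ccont_eps F z) CF (mkposreal _ (proj1 (Cmod_gt_0 _) Hz))) as [d Hd].
apply (Cdiff_intro _ (fun w => - p w * / F w * / F z)%C z d).
- apply Ccont_mult; [|apply Ccont_const].
  apply Ccont_mult; [|now apply Ccont_inv].
  apply (continuous_opp (U := AbsRing_UniformSpace C_AbsRing) (V := AbsRing_NormedModule C_AbsRing)).
  exact Hp.
- intros w Hw. specialize (Hd w Hw). simpl in Hd.
  assert (Hw0 : F w <> 0).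
  { intros E. rewrite E in Hd. replace (RtoC 0 - F z)%C with (- F z)%C in Hd by ring.
    rewrite Cmod_opp in Hd. lra. }
  replace (- p w * / F w * / F z * (w - z))%C with (- (p w * (w - z)) * / F w * / F z)%C by ring.
  replace (p w * (w - z))%C with (F w - F z)%C by (rewrite (HF w); ring).
  field; auto.
Qed.

(** * Real and polar coordinates, and the Cauchy-Riemann equations *)

Lemma Cmod_pair_le (u v : R) : Cmod (u, v) <= 2 * Rmax (Rabs u) (Rabs v).
Proof.
eapply Rle_trans; [apply Cmod_2Rmax|]. simpl.
apply Rmult_le_compat_r.
- apply Rle_trans with (1 := Rabs_pos u). apply Rmax_l.
- rewrite <- (sqrt_square 2) at 2 by lra. apply sqrt_le_1_alt. lra.
Qed.

Lemma im_le_Cmod (c : C) : Rabs (Im c) <= Cmod c.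
Proof. exact (Rle_trans _ _ _ (Rmax_r _ _) (Rmax_Cmod c)). Qed.

Lemma Ccont_locally_2d (F : C -> C) (x y : R) : Ccont F (x, y) ->
  forall eps : posreal, locally_2d (fun u v => Cmod (F (u, v) - F (x, y)) < eps) x y.
Proof.
intros H eps. destruct (proj1 (Ccont_eps F (x, y)) H eps) as [d Hd].
assert (Hp : 0 < d / 2) by (generalize (cond_pos d); lra).
exists (mkposreal _ Hp). simpl. intros u v Hu Hv. apply Hd.
eapply Rle_lt_trans; [apply (Cmod_pair_le (u - x) (v - y))|].
assert (Rmax (Rabs (u - x)) (Rabs (v - y)) < d / 2) by now apply Rmax_lub_lt.
lra.
Qed.

(** The Cauchy-Riemann equations: the linear part of [F] is multiplication by
    [phi (x, y) = a + i b], and the remainder [(phi w - phi z) * (w - z)] is small by continuity of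
    [phi]. *)
Lemma Cdiff_2d (F : C -> C) (x y : R) : Cdiff F (x, y) -> exists a b,
  differentiable_pt_lim (fun u v => Re (F (u, v))) x y a (- b) /\
  differentiable_pt_lim (fun u v => Im (F (u, v))) x y b a.
Proof.
intros [phi [Hc HF]]. exists (Re (phi (x, y))), (Im (phi (x, y))).
assert (K : forall eps : posreal, locally_2d (fun u v =>
   Cmod (F (u, v) - F (x, y) - phi (x, y) * ((u, v) - (x, y)))%C
     <= eps * Rmax (Rabs (u - x)) (Rabs (v - y))) x y).
{ intros eps. assert (Hp : 0 < eps / 2) by (generalize (cond_pos eps); lra).
  destruct (Ccont_locally_2d _ _ _ Hc (mkposreal _ Hp)) as [d Hd].
  exists d. intros u v Hu Hv. specialize (Hd u v Hu Hv). simpl in Hd.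
  rewrite (HF (u, v)).
  match goal with |- Cmod ?a <= _ =>
    replace a with ((phi (u, v) - phi (x, y)) * ((u, v) - (x, y)))%C by ring end.
  rewrite Cmod_mult.
  assert (M := Cmod_pair_le (u - x) (v - y)).
  change ((u, v) - (x, y))%C with (u - x, v - y).
  set (m := Rmax _ _) in *.
  apply Rle_trans with (eps / 2 * (2 * m)); [|lra].
  apply Rmult_le_compat; try apply Cmod_ge_0; lra. }
split; intros eps; destruct (K eps) as [d Hd]; exists d; intros u v Hu Hv;
  specialize (Hd u v Hu Hv); eapply Rle_trans; try exact Hd;
  [eapply Rle_trans; [|apply re_le_Cmod]|eapply Rle_trans; [|apply im_le_Cmod]];
  right; f_equal; unfold Cminus, Cmult, Cplus, Copp, Re, Im; simpl; ring.
Qed.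

Lemma differentiable_pt_lim_mult (f g : R -> R -> R) (x y fx fy gx gy : R) :
  differentiable_pt_lim f x y fx fy -> differentiable_pt_lim g x y gx gy ->
  differentiable_pt_lim (fun u v => f u v * g u v) x y
    (g x y * fx + f x y * gx) (g x y * fy + f x y * gy).
Proof.
intros Hf Hg. refine (differentiable_pt_lim_comp (fun p q => p * q) f g _ _ _ _ _ _ _ _ _ Hf Hg).
(* The remainder of a product is exactly the product of the two increments, one of which is below
   [eps]. *)
intros eps. exists eps. intros u v Hu Hv.
match goal with |- Rabs ?a <= _ => replace a with ((u - f x y) * (v - g x y)) by ring end.
rewrite Rabs_mult. apply Rmult_le_compat; try apply Rabs_pos; [lra|apply Rmax_r].
Qed.

Lemma differentiable_pt_lim_r (f : R -> R) (x y l : R) :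
  derivable_pt_lim f y l -> differentiable_pt_lim (fun _ v => f v) x y 0 l.
Proof.
intros H eps.
destruct (differentiable_pt_lim_proj1_0 f y x l H eps) as [d Hd].
exists d. intros u v Hu Hv. specialize (Hd v u Hv Hu).
rewrite Rmax_comm.
replace (0 * (u - x) + l * (v - y)) with (l * (v - y) + 0 * (u - x)) by ring. exact Hd.
Qed.

Definition polar (z0 : C) (r t : R) : C := (Re z0 + r * cos t, Im z0 + r * sin t).

Lemma Cmod_polar (z0 : C) (r t : R) : 0 <= r -> Cmod (polar z0 r t - z0) = r.
Proof.
intros Hr. replace (polar z0 r t - z0)%C with ((r * cos t, r * sin t) : C)
  by (unfold polar, Cminus, Cplus, Copp, Re, Im; simpl; f_equal; ring).
unfold Cmod; simpl. apply sqrt_lem_1; [nra|exact Hr|].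
assert (H := sin2_cos2 t). unfold Rsqr in H. nra.
Qed.

(* The Cauchy-Riemann equation [r U_r = V_t], in the divergence form [U_r = (V / r)_t]. *)
Lemma Cdiff_polar (F : C -> C) (z0 : C) (r t : R) : r <> 0 -> Cdiff F (polar z0 r t) ->
  exists l k m,
  differentiable_pt_lim (fun r t => Re (F (polar z0 r t))) r t l k /\
  differentiable_pt_lim (fun r t => Im (F (polar z0 r t)) * / r) r t m l.
Proof.
intros Hr HF. destruct (Cdiff_2d F _ _ HF) as [a [b [H1 H2]]].
assert (Dx : differentiable_pt_lim (fun r t => Re z0 + r * cos t) r t (cos t) (- (r * sin t))).
{ intros eps.
  destruct (differentiable_pt_lim_mult (fun u _ => u) (fun _ v => cos v) r t 1 0 0 (- sin t)
   (differentiable_pt_lim_proj1_0 (fun u => u) r t 1 (derivable_pt_lim_id r))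
   (differentiable_pt_lim_r cos r t _ (derivable_pt_lim_cos t)) eps) as [d Hd].
  exists d. intros u v Hu Hv. eapply Rle_trans; [|exact (Hd u v Hu Hv)].
  right; f_equal; ring. }
assert (Dy : differentiable_pt_lim (fun r t => Im z0 + r * sin t) r t (sin t) (r * cos t)).
{ intros eps.
  destruct (differentiable_pt_lim_mult (fun u _ => u) (fun _ v => sin v) r t 1 0 0 (cos t)
   (differentiable_pt_lim_proj1_0 (fun u => u) r t 1 (derivable_pt_lim_id r))
   (differentiable_pt_lim_r sin r t _ (derivable_pt_lim_sin t)) eps) as [d Hd].
  exists d. intros u v Hu Hv. eapply Rle_trans; [|exact (Hd u v Hu Hv)].
  right; f_equal; ring. }
assert (Di : derivable_pt_lim (fun r => / r) r (- / (r * r))).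
{ apply is_derive_Reals. evar_last; [apply is_derive_inv; [apply is_derive_id|exact Hr]|].
  unfold one; simpl. field. exact Hr. }
assert (D1 := differentiable_pt_lim_comp (fun u v => Re (F (u, v))) _ _ r t _ _ _ _ _ _ H1 Dx Dy).
assert (D2 := differentiable_pt_lim_comp (fun u v => Im (F (u, v))) _ _ r t _ _ _ _ _ _ H2 Dx Dy).
assert (D3 := differentiable_pt_lim_mult _ _ _ _ _ _ _ _ D2
   (differentiable_pt_lim_proj1_0 (fun r => / r) r t _ Di)).
cbv beta in D3.
do 3 eexists. split; [exact D1|].
(* Here the Cauchy-Riemann equation enters: the derivative of [V / r] in [t] simplifies to that of
   [U] in [r]. *)
match type of D3 with differentiable_pt_lim _ _ _ _ ?e =>
  replace (a * cos t + - b * sin t) with e by (field; exact Hr) end.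
exact D3.
Qed.

(** * Mean values on circles *)

Section CircleMean.

Variables (F : C -> C) (z0 : C) (R0 : R).
Hypothesis F_diff : forall w, Cmod (w - z0) < R0 -> w <> z0 -> Cdiff F w.
Hypothesis F_cont : Ccont F z0.

Let diff_polar r t : 0 < r < R0 -> exists l k m,
  differentiable_pt_lim (fun r t => Re (F (polar z0 r t))) r t l k /\
  differentiable_pt_lim (fun r t => Im (F (polar z0 r t)) * / r) r t m l.
Proof.
intros Hr. apply Cdiff_polar; [lra|].
assert (H := Cmod_polar z0 r t ltac:(lra)). apply F_diff; [lra|].
intros E. rewrite E in H. replace (z0 - z0)%C with (RtoC 0) in H by ring.
rewrite Cmod_0 in H. lra.
Qed.

Let ex_circle r : 0 < r < R0 -> ex_RInt (fun t => Re (F (polar z0 r t))) 0 (2 * PI).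
Proof.
intros Hr. apply (ex_RInt_continuous (V := R_CompleteNormedModule)).
intros t _. destruct (diff_polar r t Hr) as [l [k [m [H _]]]].
apply (continuity_2d_pt_continuous_r (fun r t => Re (F (polar z0 r t)))).
apply differentiable_continuity_pt. exists l, k. exact H.
Qed.

(** Green's formula on the rectangle [[r1, r2] x [0, 2 PI]] of the polar plane; the sides [t = 0]
    and [t = 2 PI] cancel by periodicity. *)
Let circle_indep r1 r2 : 0 < r1 < r2 -> r2 < R0 ->
  RInt (fun t => Re (F (polar z0 r2 t))) 0 (2 * PI) =
  RInt (fun t => Re (F (polar z0 r1 t))) 0 (2 * PI).
Proof.
intros Hr1 Hr2. assert (Hpi := PI_RGT_0).
assert (G := green_rectangle (fun r t => Re (F (polar z0 r t)))
  (fun r t => Im (F (polar z0 r t)) * / r) r1 (r2 - r1) 0 (2 * PI) ltac:(lra) ltac:(lra)).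
simpl in G. replace (r1 + (r2 - r1)) with r2 in G by ring. rewrite Rplus_0_l in G.
assert (E : RInt (fun t => Re (F (polar z0 r2 t)) - Re (F (polar z0 r1 t))) 0 (2 * PI) = 0).
{ rewrite G by (intros; apply diff_polar; lra).
  rewrite (RInt_ext _ (fun _ => 0)).
  - rewrite (RInt_const (V := R_CompleteNormedModule)). unfold scal; simpl; unfold mult; simpl. ring.
  - intros r _. unfold polar. rewrite cos_2PI, sin_2PI, cos_0, sin_0.
    exact (Rminus_diag_eq _ _ eq_refl). }
rewrite (RInt_minus (V := R_CompleteNormedModule) (fun t => Re (F (polar z0 r2 t)))
   (fun t => Re (F (polar z0 r1 t)))) in E by (apply ex_circle; lra).
unfold minus, plus, opp in E; simpl in E. lra.
Qed.

(** The integral is the same over all smaller circles, and over a tiny one [F] is nearly [F z0] by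
    continuity at the centre. *)
Lemma circle_mean r : 0 < r < R0 ->
  RInt (fun t => Re (F (polar z0 r t))) 0 (2 * PI) = 2 * PI * Re (F z0).
Proof.
intros Hr. assert (Hpi := PI_RGT_0). apply Rminus_diag_uniq.
set (D := _ - _). destruct (Req_dec D 0) as [H|H]; [exact H|exfalso].
(* Over an interval of length [2 PI] this tolerance adds up to [Rabs D / 2], less than [Rabs D]. *)
apply Rabs_pos_lt in H. assert (He : 0 < Rabs D / (4 * PI)) by (apply Rdiv_lt_0_compat; lra).
destruct (proj1 (Ccont_eps F z0) F_cont (mkposreal _ He)) as [d Hd]. simpl in Hd.
assert (Hm := Rmin_l (r / 2) (d / 2)). assert (Hm' := Rmin_r (r / 2) (d / 2)).
assert (Hs : 0 < Rmin (r / 2) (d / 2)) by (apply Rmin_pos; generalize (cond_pos d); lra).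
set (s := Rmin (r / 2) (d / 2)) in *.
assert (N : Rabs D <= (2 * PI - 0) * (Rabs D / (4 * PI))).
{ unfold D at 1. rewrite (circle_indep s r) by lra.
  replace (2 * PI * Re (F z0)) with (Re (F z0) * (2 * PI - 0)) by ring.
  apply RInt_near_const; [lra|apply ex_circle; lra|].
  intros t _. left. eapply Rle_lt_trans; [|apply (Hd (polar z0 s t))].
  - eapply Rle_trans; [|apply re_le_Cmod]. right. f_equal.
  - rewrite Cmod_polar by lra. generalize (cond_pos d); lra. }
replace ((2 * PI - 0) * (Rabs D / (4 * PI))) with (Rabs D / 2) in N by (field; lra). lra.
Qed.

Lemma circle_not_dominated (c : R) r : 0 < r < R0 -> c < Re (F z0) ->
  ~ (forall t, Re (F (polar z0 r t)) <= c).
Proof.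
intros Hr Hc H. assert (Hpi := PI_RGT_0).
assert (E := circle_mean r Hr).
assert (L : RInt (fun t => Re (F (polar z0 r t))) 0 (2 * PI) <= RInt (fun _ => c) 0 (2 * PI)).
{ apply RInt_le; [lra|now apply ex_circle|apply (ex_RInt_const (V := R_NormedModule))|].
  intros t _. apply H. }
rewrite E, (RInt_const (V := R_CompleteNormedModule)) in L.
unfold scal in L; simpl in L; unfold mult in L; simpl in L. nra.
Qed.

End CircleMean.

(** * Maximum modulus principle *)

(** Compactness by bisection. Without a maximum, each point of [D] has a neighbourhood on which
    [Phi] stays below some value it takes on [D]; a point outside [D] has one that misses [D]. Four
    such values have a largest, so bisection finds a single value that bounds [Phi] on all of [D],
    hence a maximum. *)
Lemma continuous_attains_max (D : R -> R -> Prop) (Phi : R -> R -> R) (rho : R) :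
  (exists x y, D x y) ->
  (forall x y, D x y -> Rabs x <= rho /\ Rabs y <= rho) ->
  (forall x y, ~ D x y -> locally_2d (fun u v => ~ D u v) x y) ->
  (forall x y, D x y -> continuity_2d_pt Phi x y) ->
  exists x y, D x y /\ forall u v, D u v -> Phi u v <= Phi x y.
Proof.
intros [x0 [y0 H0]] Hbd Hcl Hc.
destruct (classic (exists x y, D x y /\ forall u v, D u v -> Phi u v <= Phi x y))
  as [H|Hno]; [exact H|exfalso].
assert (Hup : forall x y, D x y -> exists u v, D u v /\ Phi x y < Phi u v).
{ intros x y Hxy. apply NNPP. intros N. apply Hno. exists x, y. split; [exact Hxy|].
  intros u v Huv. apply Rnot_lt_le. intros L. apply N. exists u, v. auto. }
set (P := fun x y s => exists u v, D u v /\
   forall x' y', x <= x' <= x + s * (2 * rho) -> y <= y' <= y + s * (2 * rho) ->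
     D x' y' -> Phi x' y' <= Phi u v).
assert (Hrho : 0 <= rho).
{ apply Rle_trans with (1 := Rabs_pos x0). apply (Hbd x0 y0 H0). }
assert (HP : P (- rho) (- rho) 1).
{ apply (rectangle_bisection P (- rho) (- rho) (2 * rho) (2 * rho)); [lra|lra| |].
  - intros x y s Hs _ [u1 [v1 [D1 K1]]] [u2 [v2 [D2 K2]]] [u3 [v3 [D3 K3]]] [u4 [v4 [D4 K4]]].
    assert (max2 : forall a b a' b', D a b -> D a' b' -> exists u v, D u v /\
      Phi a b <= Phi u v /\ Phi a' b' <= Phi u v).
    { intros a b a' b' Ha Hb. destruct (Rle_or_lt (Phi a b) (Phi a' b')).
      - exists a', b'. split; [auto|lra].
      - exists a, b. split; [auto|lra]. }
    destruct (max2 _ _ _ _ D1 D2) as [p [q [Dpq [M1 M2]]]].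
    destruct (max2 _ _ _ _ D3 D4) as [p' [q' [Dpq' [M3 M4]]]].
    destruct (max2 _ _ _ _ Dpq Dpq') as [u [v [Duv [M5 M6]]]].
    exists u, v. split; [exact Duv|]. intros x' y' Hx Hy Hxy.
    assert (EA : s * (2 * rho) = s / 2 * (2 * rho) + s / 2 * (2 * rho)) by field.
    destruct (Rle_or_lt x' (x + s / 2 * (2 * rho))); destruct (Rle_or_lt y' (y + s / 2 * (2 * rho))).
    + specialize (K1 x' y' ltac:(lra) ltac:(lra) Hxy). lra.
    + specialize (K3 x' y' ltac:(lra) ltac:(lra) Hxy). lra.
    + specialize (K2 x' y' ltac:(lra) ltac:(lra) Hxy). lra.
    + specialize (K4 x' y' ltac:(lra) ltac:(lra) Hxy). lra.
  - intros p q _ _.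
    assert (L : exists u v, D u v /\
       locally_2d (fun x' y' => D x' y' -> Phi x' y' <= Phi u v) p q).
    { destruct (classic (D p q)) as [Hpq|Hpq].
      - destruct (Hup p q Hpq) as [u [v [Huv L]]]. exists u, v. split; [exact Huv|].
        assert (He : 0 < Phi u v - Phi p q) by lra.
        destruct (Hc p q Hpq (mkposreal _ He)) as [d Hd]. exists d. simpl in Hd.
        intros x' y' Hx Hy _. specialize (Hd x' y' Hx Hy).
        apply Rabs_lt_between in Hd. lra.
      - exists x0, y0. split; [exact H0|]. destruct (Hcl p q Hpq) as [d Hd].
        exists d. intros x' y' Hx Hy Hxy. elim (Hd x' y' Hx Hy Hxy). }
    destruct L as [u [v [Huv [d Hd]]]].
    (* The summand 1 keeps the denominator positive when [rho = 0]. *)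
    assert (He : 0 < d / (2 * rho + 1)) by (apply Rdiv_lt_0_compat; [apply cond_pos|lra]).
    exists (mkposreal _ He). simpl. intros x y s [Hs1 Hs2] _ Hx Hy.
    exists u, v. split; [exact Huv|]. intros x' y' Hx' Hy' Hxy.
    apply Rlt_div_r in Hs2; [|lra].
    apply Hd; [| |exact Hxy]; apply Rabs_lt_between; lra. }
destruct HP as [u [v [Huv K]]]. destruct (Hup u v Huv) as [u' [v' [Huv' L]]].
destruct (Hbd u' v' Huv') as [B1 B2].
apply Rabs_le_between in B1. apply Rabs_le_between in B2.
specialize (K u' v' ltac:(lra) ltac:(lra) Huv'). lra.
Qed.

(** A small disc around the maximum point then meets the exceptional set at most in its centre,
    where the mean value property only asks for continuity. *)
Lemma finite_isolated (E : list C) (z : C) :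
  exists d : posreal, forall w, Cmod (w - z) < d -> w <> z -> ~ In w E.
Proof.
induction E as [|e E [d Hd]].
- exists (mkposreal 1 Rlt_0_1). intros w _ _ [].
- destruct (Ceq_dec e z) as [->|Hn].
  + exists d. intros w Hw Hwz [Hz|HE]; [congruence|exact (Hd w Hw Hwz HE)].
  + assert (Hp := proj1 (Cmod_gt_0 _) (Cminus_eq_contra _ _ Hn)).
    exists (mkposreal _ (Rmin_pos _ _ Hp (cond_pos d))). simpl.
    intros w Hw Hwz [He|HE].
    * subst e. generalize (Rmin_l (Cmod (w - z)) d). lra.
    * generalize (Rmin_r (Cmod (e - z)) d). intros. apply (Hd w); auto. lra.
Qed.

Lemma Cmod_sqr (z : C) : Cmod z * Cmod z = Re z * Re z + Im z * Im z.
Proof. generalize (Cmod2_alt z). simpl. lra. Qed.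

Lemma Cmod_le_minus (w z : C) : Cmod z <= Cmod w + Cmod (w - z).
Proof.
rewrite <- (Cmod_opp (w - z)). eapply Rle_trans; [|apply Cmod_triangle].
right. f_equal. ring.
Qed.

Lemma max_modulus (F : C -> C) (E : list C) (rho R0 M : R) : 0 < rho < R0 ->
  (forall z, Cmod z < R0 -> Ccont F z) ->
  (forall z, Cmod z < R0 -> ~ In z E -> Cdiff F z) ->
  (forall z, Cmod z = rho -> Cmod (F z) <= M) ->
  forall z, Cmod z <= rho -> Cmod (F z) <= M.
Proof.
intros Hrho Hc Hd HM z Hz. apply Rnot_lt_le. intros Hlt.
assert (HM0 : 0 <= M).
{ apply Rle_trans with (1 := Cmod_ge_0 (F rho)). apply HM.
  rewrite Cmod_R. apply Rabs_pos_eq. lra. }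
(* [|F|^2 + eps |z|^2] is strictly subharmonic, so its maximum over the closed disc
   must be on the circle [|z| = rho], where [eps] makes it less than its value at [z]. *)
set (eps := (Cmod (F z) * Cmod (F z) - M * M) / (2 * (rho * rho))).
assert (He : 0 < eps) by (apply Rdiv_lt_0_compat; nra).
assert (Ee : eps * (rho * rho) = (Cmod (F z) * Cmod (F z) - M * M) / 2)
  by (unfold eps; field; lra).
set (sq := fun w : C => Re w * Re w + Im w * Im w).
set (Phi := fun w : C => sq (F w) + eps * sq w).
destruct (continuous_attains_max (fun x y => Cmod (x, y) <= rho)
  (fun x y => Phi (x, y)) rho) as [x0 [y0 [H0 Hmax]]].
- exists (Re z), (Im z). destruct z; exact Hz.
- intros x y H. split; eapply Rle_trans; try exact H;
    [apply (re_le_Cmod (x, y))|apply (im_le_Cmod (x, y))].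
- intros x y H. apply Rnot_le_lt in H.
  assert (Hp : 0 < (Cmod (x, y) - rho)) by lra.
  destruct (Ccont_locally_2d (fun w => w) x y (Ccont_id _) (mkposreal _ Hp)) as [d Hdd].
  exists d. intros u v Hu Hv Huv. specialize (Hdd u v Hu Hv). simpl in Hdd.
  assert (T := Cmod_le_minus (u, v) (x, y)). lra.
- intros x y H.
  assert (CF : forall eps : posreal,
     locally_2d (fun u v => Cmod (F (u, v) - F (x, y)) < eps) x y)
    by (apply Ccont_locally_2d, Hc; lra).
  assert (CR : continuity_2d_pt (fun u v => Re (F (u, v))) x y).
  { intros e. destruct (CF e) as [d K]. exists d. intros u v Hu Hv.
    eapply Rle_lt_trans; [|exact (K u v Hu Hv)]. exact (re_le_Cmod (F (u, v) - F (x, y))). }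
  assert (CI : continuity_2d_pt (fun u v => Im (F (u, v))) x y).
  { intros e. destruct (CF e) as [d K]. exists d. intros u v Hu Hv.
    eapply Rle_lt_trans; [|exact (K u v Hu Hv)]. exact (im_le_Cmod (F (u, v) - F (x, y))). }
  unfold Phi, sq.
  repeat first [apply continuity_2d_pt_plus|apply continuity_2d_pt_mult];
    try assumption; try apply continuity_2d_pt_const;
    try apply continuity_2d_pt_id1; apply continuity_2d_pt_id2.
- set (z0 := (x0, y0) : C) in *.
  assert (Hmax' : forall w, Cmod w <= rho -> Phi w <= Phi z0).
  { intros [u v] Hw. apply Hmax, Hw. }
  clear Hmax.
  assert (Hphi : forall w, Phi w = Cmod (F w) * Cmod (F w) + eps * (Cmod w * Cmod w)).
  { intros w. rewrite !Cmod_sqr. reflexivity. }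
  assert (Hin : Cmod z0 < rho).
  { destruct (Rle_lt_or_eq_dec _ _ H0) as [H|H]; [exact H|exfalso].
    assert (K := Hmax' z Hz). rewrite !Hphi, H in K. specialize (HM z0 H).
    assert (Cmod (F z0) * Cmod (F z0) <= M * M)
      by (apply Rmult_le_compat; auto using Cmod_ge_0).
    assert (0 <= eps * (Cmod z * Cmod z))
      by (apply Rmult_le_pos; [lra|apply Rle_0_sqr]).
    nra. }
  destruct (finite_isolated E z0) as [d Hiso].
  set (R1 := Rmin d (rho - Cmod z0)).
  assert (HR1 : 0 < R1) by (apply Rmin_pos; [apply cond_pos|lra]).
  assert (HR1a := Rmin_l d (rho - Cmod z0)). assert (HR1b := Rmin_r d (rho - Cmod z0)).
  fold R1 in HR1a, HR1b.
  assert (Hnear : forall w, Cmod (w - z0) < R1 -> Cmod w <= rho).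
  { intros w Hw. assert (T := Cmod_triangle (w - z0) z0).
    replace (w - z0 + z0)%C with w in T by ring. lra. }
  (* Polarising at the maximum: [Re G] is harmonic and
     [2 Re (G w) <= Phi w + Phi z0 - eps |w - z0|^2], with equality at [z0]. *)
  set (G := fun w => (Cconj (F z0) * F w + RtoC eps * Cconj z0 * w)%C).
  assert (HG : forall w, Re (G w) = Re (F z0) * Re (F w) + Im (F z0) * Im (F w)
     + eps * (Re z0 * Re w + Im z0 * Im w)).
  { intros w. unfold G. rewrite re_plus, !re_mult, im_mult, re_RtoC, im_RtoC, !re_conj, !im_conj.
    ring. }
  refine (circle_not_dominated G z0 R1 _ _ (Phi z0 - eps * ((R1 / 2) * (R1 / 2)) / 2) (R1 / 2) _ _ _).
  + intros w Hw Hn. apply Cdiff_plus.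
    * apply Cdiff_mult; [apply Cdiff_const|].
      apply Hd; [specialize (Hnear w Hw); lra|]. apply Hiso; [lra|exact Hn].
    * apply Cdiff_mult; [apply Cdiff_const|apply Cdiff_id].
  + apply Ccont_plus.
    * apply Ccont_mult; [apply Ccont_const|]. apply Hc; lra.
    * apply Ccont_mult; [apply Ccont_const|apply Ccont_id].
  + lra.
  + rewrite HG. unfold Phi, sq. assert (0 < eps * (R1 / 2 * (R1 / 2))).
    { apply Rmult_lt_0_compat; [exact He|nra]. } lra.
  + intros t. set (w := polar z0 (R1 / 2) t).
    assert (Hw : Cmod (w - z0) = R1 / 2) by (apply Cmod_polar; lra).
    assert (K := Hmax' w (Hnear w ltac:(lra))).
    assert (K2 := Cmod_sqr (w - z0)). rewrite Hw in K2. rewrite K2, HG.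
    change (Re (w - z0)) with (Re w - Re z0). change (Im (w - z0)) with (Im w - Im z0).
    unfold Phi, sq in *.
    assert (S1 := Rle_0_sqr (Re (F w) - Re (F z0))).
    assert (S2 := Rle_0_sqr (Im (F w) - Im (F z0))). unfold Rsqr in *.
    nra.
Qed.

(** * The Schwarz-Pick inequality *)

(** The factor is the difference quotient, completed by [l] at [z]; the estimate that defines the
    derivative, divided by [|w - z|], is its continuity. *)
Lemma is_derive_Caratheodory (F : C -> C) (z l : C) :
  @is_derive C_AbsRing C_NormedModule F z l ->
  exists phi, Ccont phi z /\ phi z = l /\ forall w, F w = (F z + phi w * (w - z))%C.
Proof.
intros [_ H]. specialize (H z (fun P HP => HP)).
set (phi := fun w => if Ceq_dec w z then l else ((F w - F z) / (w - z))%C).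
assert (Hz : phi z = l).
{ unfold phi. destruct (Ceq_dec z z) as [_|N]; [reflexivity|now elim N]. }
exists phi. repeat split; [|exact Hz|].
- apply Ccont_eps. intros eps.
  assert (He : 0 < eps / 2) by (generalize (cond_pos eps); lra).
  destruct (H (mkposreal _ He)) as [d Hd]. exists d. intros w Hw. rewrite Hz.
  assert (K : Cmod (F w - F z - (w - z) * l) <= eps / 2 * Cmod (w - z)) by exact (Hd w Hw).
  unfold phi. destruct (Ceq_dec w z) as [->|N].
  + replace (l - l)%C with (RtoC 0) by ring. rewrite Cmod_0. apply cond_pos.
  + assert (Hn := Cminus_eq_contra _ _ N). assert (Hp := proj1 (Cmod_gt_0 _) Hn).
    replace ((F w - F z) / (w - z) - l)%C with ((F w - F z - (w - z) * l) / (w - z))%C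
      by (field; exact Hn).
    rewrite Cmod_div by exact Hn. apply Rlt_div_l; [exact Hp|]. nra.
- intros w. unfold phi. destruct (Ceq_dec w z) as [->|N]; [ring|].
  field. now apply Cminus_eq_contra.
Qed.

(** Away from [z1] the factor [K] is recovered by division, and so inherits continuity and
    differentiability from [F]. *)
Lemma quotient_locally (F K : C -> C) (z1 z : C) : z <> z1 ->
  (forall w, F w = (K w * (w - z1))%C) ->
  exists d : posreal, forall w, Cmod (w - z) < d -> (F w * / (w + - z1) = K w)%C.
Proof.
intros Hn HF. assert (Hp := proj1 (Cmod_gt_0 _) (Cminus_eq_contra _ _ (not_eq_sym Hn))).
exists (mkposreal _ Hp). intros w Hw. simpl in Hw. rewrite (HF w). field.
intros E. replace w with z1 in Hw; [lra|].
symmetry. apply Ceq_minus. exact E.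
Qed.

Lemma Ccont_quotient (F K : C -> C) (z1 z : C) : z <> z1 ->
  (forall w, F w = (K w * (w - z1))%C) -> Ccont F z -> Ccont K z.
Proof.
intros Hn HF HC. destruct (quotient_locally F K z1 z Hn HF) as [d Hd].
apply (Ccont_ext_loc _ K z d Hd). apply Ccont_mult; [exact HC|].
apply Ccont_inv; [|exact (Cminus_eq_contra _ _ Hn)].
apply Ccont_plus; [apply Ccont_id|apply Ccont_const].
Qed.

Lemma Cdiff_quotient (F K : C -> C) (z1 z : C) : z <> z1 ->
  (forall w, F w = (K w * (w - z1))%C) -> Cdiff F z -> Cdiff K z.
Proof.
intros Hn HF HC. destruct (quotient_locally F K z1 z Hn HF) as [d Hd].
apply (Cdiff_ext_loc _ K z d Hd). apply Cdiff_mult; [exact HC|].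
apply Cdiff_inv; [exact (Cminus_eq_contra _ _ Hn)|].
apply Cdiff_plus; [apply Cdiff_id|apply Cdiff_const].
Qed.

(** On the circle of radius [rho > c] the hypothesis gives [|F| <= 1 / (rho - c)]; the maximum
    principle carries this inside, and [rho] may be taken close to 1. The shift [c] is 0 for
    [f z / z] and [|z1|] for a quotient by [z - z1]. *)
Lemma max_modulus_boundary (F : C -> C) (E : list C) (c : R) : 0 <= c < 1 ->
  (forall z, Cmod z < 1 -> Ccont F z) ->
  (forall z, Cmod z < 1 -> ~ In z E -> Cdiff F z) ->
  (forall z, Cmod z < 1 -> Cmod (F z) * (Cmod z - c) <= 1) ->
  forall z, Cmod z < 1 -> Cmod (F z) * (1 - c) <= 1.
Proof.
intros Hc HC HD HB z Hz. apply Rnot_lt_le. intros Hlt.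
assert (HX0 := Cmod_ge_0 (F z)). set (X := Cmod (F z)) in *.
assert (HX : 0 < X) by nra.
assert (HX1 : X * (c + / X) < X * 1) by (rewrite Rmult_plus_distr_l, Rinv_r; nra).
apply Rmult_lt_reg_l in HX1; [|exact HX].
assert (Hi := Rinv_0_lt_compat X HX).
(* A radius beyond [Cmod z] encloses [z], and one beyond [c + / X] makes [X * (rho - c) > 1],
   against the bound on the circle. *)
set (m := Rmax (Cmod z) (c + / X)).
assert (M1 := Rmax_l (Cmod z) (c + / X)). assert (M2 := Rmax_r (Cmod z) (c + / X)).
assert (M3 : m < 1) by now apply Rmax_lub_lt. fold m in M1, M2.
set (rho := (m + 1) / 2). assert (Hrho : m < rho < 1) by (unfold rho; lra).
assert (K : X <= / (rho - c)).
{ apply (max_modulus F E rho 1); try assumption; [lra| |lra].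
  intros w Hw. assert (B := HB w ltac:(lra)). rewrite Hw in B.
  apply Rmult_le_reg_r with (rho - c); [lra|]. rewrite Rinv_l by lra. exact B. }
assert (K2 : X * / X < X * (rho - c)) by (apply Rmult_lt_compat_l; lra).
rewrite Rinv_r in K2 by lra.
assert (K3 : X * (rho - c) <= / (rho - c) * (rho - c)) by (apply Rmult_le_compat_r; lra).
rewrite Rinv_l in K3 by lra. lra.
Qed.

Lemma Cmod_Cconj_mult_le (a w : C) : Re (Cconj a * w) <= Cmod a * Cmod w.
Proof.
rewrite <- (Cmod_conj a), <- Cmod_mult.
apply Rle_trans with (1 := Rle_abs _). apply re_le_Cmod.
Qed.

Lemma Cmod_minus_sqr (a w : C) :
  Cmod (w - a) * Cmod (w - a) =
  Cmod w * Cmod w + Cmod a * Cmod a - 2 * Re (Cconj a * w).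
Proof.
rewrite !Cmod_sqr. unfold Cminus.
rewrite !re_plus, !im_plus, !re_opp, !im_opp, !re_mult, !re_conj, !im_conj. ring.
Qed.

Lemma Cmod_one_minus_sqr (a w : C) :
  Cmod (1 - Cconj a * w) * Cmod (1 - Cconj a * w) =
  1 + Cmod a * Cmod a * (Cmod w * Cmod w) - 2 * Re (Cconj a * w).
Proof.
rewrite !Cmod_sqr. unfold Cminus.
rewrite !re_plus, !im_plus, !re_opp, !im_opp, !re_mult, !im_mult, !re_conj, !im_conj.
rewrite re_RtoC, im_RtoC. ring.
Qed.

Lemma one_minus_neq_0 (a w : C) : Cmod a < 1 -> Cmod w <= 1 -> (1 - Cconj a * w)%C <> 0.
Proof.
intros Ha Hw E. assert (E' : (Cconj a * w)%C = 1) by (symmetry; now apply Ceq_minus).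
apply (f_equal Cmod) in E'. rewrite Cmod_mult, Cmod_conj, Cmod_1 in E'.
assert (H := Cmod_ge_0 a). assert (H' := Cmod_ge_0 w). nra.
Qed.

(** This is [|1 - conj a w|^2 - |w - a|^2 = (1 - |a|^2) (1 - |w|^2) >= 0]. *)
Lemma Cmod_Moebius_le (a w : C) : Cmod a < 1 -> Cmod w <= 1 ->
  Cmod ((w + - a) * / (1 + - Cconj a * w)) <= 1.
Proof.
intros Ha Hw. assert (Hn := one_minus_neq_0 a w Ha Hw).
replace ((w + - a) * / (1 + - Cconj a * w))%C with ((w - a) / (1 - Cconj a * w))%C
  by (unfold Cdiv, Cminus; f_equal; f_equal; ring).
rewrite Cmod_div by exact Hn. apply Rle_div_l; [now apply Cmod_gt_0|].
rewrite Rmult_1_l. apply Rsqr_incr_0; try apply Cmod_ge_0. unfold Rsqr.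
rewrite Cmod_minus_sqr, Cmod_one_minus_sqr.
assert (H := Cmod_ge_0 a). assert (H' := Cmod_ge_0 w).
assert (0 <= (1 - Cmod a * Cmod a) * (1 - Cmod w * Cmod w)) by (apply Rmult_le_pos; nra).
nra.
Qed.

(* [g] is not known to be differentiable at [0], so the inequality is proved first
   for a base point [z1 <> 0], and then [z1 -> 0]. *)
Lemma Schwarz_Pick_continuous_at_0 (g : C -> C) :
  Ccont g (RtoC 0) -> (forall z, Cmod z < 1 -> z <> 0 -> Cdiff g z) ->
  (forall z, Cmod z < 1 -> Cmod (g z) <= 1) -> Cmod (g 0) < 1 ->
  forall z, Cmod z < 1 ->
    Cmod (g z - g 0) <= Cmod z * Cmod (1 - Cconj (g 0) * g z).
Proof.
intros Hc0 Hd Hb Ha z Hz.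
assert (Hc : forall w, Cmod w < 1 -> Ccont g w).
{ intros w Hw. destruct (Ceq_dec w 0) as [->|N]; [exact Hc0|]. apply Cdiff_cont; auto. }
(* Compose [g] with the Moebius map that sends [g z1] to 0 and divide by [w - z1]. The quotient [K]
   satisfies [|K w| (|w| - |z1|) <= |K w| |w - z1| = |F w| <= 1], hence the factor [1 - |z1|], which
   tends to 1 with [z1 -> 0]. *)
assert (Hbase : forall z1, 0 < Cmod z1 < 1 -> Cmod (g z1) < 1 ->
  Cmod (g z - g z1) * (1 - Cmod z1) <= Cmod (z - z1) * Cmod (1 - Cconj (g z1) * g z)).
{ intros z1 Hz1 Hg1. set (b := g z1) in *.
  set (F := fun w => ((g w + - b) * / (1 + - Cconj b * g w))%C).
  assert (Hn : forall w, Cmod w < 1 -> (1 + - Cconj b * g w)%C <> 0).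
  { intros w Hw. replace (1 + - Cconj b * g w)%C with (1 - Cconj b * g w)%C by ring.
    apply one_minus_neq_0; auto. }
  assert (FD : forall w, Cmod w < 1 -> w <> 0 -> Cdiff F w).
  { intros w Hw Hw0. apply Cdiff_mult; [apply Cdiff_plus; [auto|apply Cdiff_const]|].
    apply (Cdiff_inv (fun w => 1 + - Cconj b * g w)%C); [auto|].
    apply Cdiff_plus; [apply Cdiff_const|]. apply Cdiff_mult; [apply Cdiff_const|auto]. }
  assert (FC : forall w, Cmod w < 1 -> Ccont F w).
  { intros w Hw. apply Ccont_mult; [apply Ccont_plus; [auto|apply Ccont_const]|].
    apply (Ccont_inv (fun w => 1 + - Cconj b * g w)%C); [|auto].
    apply Ccont_plus; [apply Ccont_const|]. apply Ccont_mult; [apply Ccont_const|auto]. }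
  assert (Hz10 : z1 <> 0) by (apply Cmod_gt_0; lra).
  destruct (FD z1 (proj2 Hz1) Hz10) as [K [KC KF]].
  assert (FK : forall w, F w = (K w * (w - z1))%C).
  { intros w. rewrite (KF w). replace (F z1) with (RtoC 0); [ring|].
    unfold F. fold b. ring. }
  assert (KB : Cmod (K z) * (1 - Cmod z1) <= 1).
  { apply (max_modulus_boundary K (RtoC 0 :: z1 :: nil)); [lra| | |  |exact Hz].
    - intros w Hw. destruct (Ceq_dec w z1) as [->|N]; [exact KC|].
      apply (Ccont_quotient F K z1); auto.
    - intros w Hw Hi. apply (Cdiff_quotient F K z1); auto.
      + intros ->. apply Hi. simpl. auto.
      + apply FD; auto. intros ->. apply Hi. simpl. auto.
    - intros w Hw. apply Rle_trans with (Cmod (K w) * Cmod (w - z1)).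
      + apply Rmult_le_compat_l; [apply Cmod_ge_0|].
        assert (T := Cmod_le_minus z1 w). rewrite <- (Cmod_opp (z1 - w)) in T.
        replace (- (z1 - w))%C with (w - z1)%C in T by ring. lra.
      + rewrite <- Cmod_mult, <- FK. apply Cmod_Moebius_le; auto. }
  replace (g z - b)%C with (F z * (1 - Cconj b * g z))%C.
  - rewrite FK, !Cmod_mult.
    assert (0 <= Cmod (z - z1) * Cmod (1 - Cconj b * g z))
      by (apply Rmult_le_pos; apply Cmod_ge_0).
    nra.
  - unfold F. field. exact (Hn z Hz). }
set (a := g 0) in *.
apply Rnot_lt_le. intros Hlt.
set (Y := Cmod (1 - Cconj a * g z)) in *.
assert (HY : Y <= 2).
{ unfold Y, Cminus. eapply Rle_trans; [apply Cmod_triangle|].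
  rewrite Cmod_opp, Cmod_1, Cmod_mult, Cmod_conj.
  assert (H := Hb z Hz). assert (H' := Cmod_ge_0 a). assert (H'' := Cmod_ge_0 (g z)). nra. }
assert (HY0 : 0 <= Y) by apply Cmod_ge_0. assert (Hz0 := Cmod_ge_0 z).
set (gap := Cmod (g z - a) - Cmod z * Y).
(* Moving the base point from 0 to some [t <= e] costs less than [8 * e] in the inequality: [e] for
   [g], [2 * t] for the factor [1 - t], and [e * (|z| + Y + e)] for the right side, with [Y <= 2].
   The second bound ensures [|g t| < 1]. *)
assert (He : 0 < Rmin (gap / 8) ((1 - Cmod a) / 2)) by (apply Rmin_pos; unfold gap; lra).
assert (E1 := Rmin_l (gap / 8) ((1 - Cmod a) / 2)).
assert (E2 := Rmin_r (gap / 8) ((1 - Cmod a) / 2)).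
set (e := Rmin _ _) in *.
assert (Ha0 := Cmod_ge_0 a).
destruct (proj1 (Ccont_eps g 0) Hc0 (mkposreal _ He)) as [d Hdd]. simpl in Hdd. fold a in Hdd.
assert (T1 := Rmin_l (d / 2) e). assert (T2 := Rmin_r (d / 2) e).
assert (T0 : 0 < Rmin (d / 2) e) by (apply Rmin_pos; generalize (cond_pos d); lra).
set (t := Rmin (d / 2) e) in *.
assert (Ht : Cmod t = t) by (rewrite Cmod_R; apply Rabs_pos_eq; lra).
assert (Hgt : Cmod (g t - a) < e).
{ apply Hdd. replace (t - 0)%C with (RtoC t) by ring. rewrite Ht. generalize (cond_pos d); lra. }
assert (Hgt1 : Cmod (g t) < 1).
{ assert (T := Cmod_triangle (g t - a) a).
  replace (g t - a + a)%C with (g t) in T by ring. lra. }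
assert (B := Hbase t ltac:(rewrite Ht; lra) Hgt1). rewrite Ht in B.
assert (B1 : Cmod (z - t) <= Cmod z + t).
{ unfold Cminus. eapply Rle_trans; [apply Cmod_triangle|]. rewrite Cmod_opp, Ht. lra. }
assert (B2 : Cmod (1 - Cconj (g t) * g z) <= Y + e).
{ replace (1 - Cconj (g t) * g z)%C with
    ((1 - Cconj a * g z) + - (Cconj (g t - a) * g z))%C by (rewrite Cminus_conj; ring).
  eapply Rle_trans; [apply Cmod_triangle|]. fold Y.
  rewrite Cmod_opp, Cmod_mult, Cmod_conj.
  assert (H := Hb z Hz). assert (H' := Cmod_ge_0 (g t - a)).
  assert (H'' := Cmod_ge_0 (g z)). nra. }
assert (B3 : Cmod (g z - a) <= Cmod (g z - g t) + e).
{ replace (g z - a)%C with ((g z - g t) + (g t - a))%C by ring.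
  eapply Rle_trans; [apply Cmod_triangle|]. lra. }
assert (B4 : Cmod (g z - g t) <= 2).
{ unfold Cminus. eapply Rle_trans; [apply Cmod_triangle|]. rewrite Cmod_opp.
  specialize (Hb z Hz). lra. }
assert (B5 : Cmod (z - t) * Cmod (1 - Cconj (g t) * g z) <= (Cmod z + e) * (Y + e)).
{ apply Rmult_le_compat; try apply Cmod_ge_0; lra. }
assert (B6 := Cmod_ge_0 (g z - g t)).
unfold gap in E1. nra.
Qed.

(** After squaring, [Re (conj a w)] has the coefficient [2 (1 - r^2) >= 0], so the worst case is
    [|a| |w|]. There the inequality reads [(W - A)^2 <= r^2 (1 - A W)^2]; the root is taken and
    solved for [W]. *)
Lemma pseudohyperbolic_bound (a w : C) (r : R) : Cmod a <= 1 -> Cmod w <= 1 -> 0 <= r < 1 ->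
  Cmod (w - a) <= r * Cmod (1 - Cconj a * w) ->
  Cmod w <= (r + Cmod a) / (1 + Cmod a * r).
Proof.
intros Ha Hw Hr H.
assert (A0 := Cmod_ge_0 a). assert (W0 := Cmod_ge_0 w).
assert (S : Cmod (w - a) * Cmod (w - a) <=
   (r * Cmod (1 - Cconj a * w)) * (r * Cmod (1 - Cconj a * w)))
  by (apply Rmult_le_compat; auto using Cmod_ge_0).
replace (r * Cmod (1 - Cconj a * w) * (r * Cmod (1 - Cconj a * w))) with
  (r * r * (Cmod (1 - Cconj a * w) * Cmod (1 - Cconj a * w))) in S by ring.
rewrite Cmod_minus_sqr, Cmod_one_minus_sqr in S.
assert (L := Cmod_Cconj_mult_le a w).
set (A := Cmod a) in *. set (W := Cmod w) in *. set (c := Re _) in *.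
apply Rle_div_r; [nra|].
assert (Q : (W - A) * (W - A) <= (r * (1 - A * W)) * (r * (1 - A * W))).
{ assert (c * (1 - r * r) <= A * W * (1 - r * r)) by (apply Rmult_le_compat_r; nra). nra. }
assert (0 <= r * (1 - A * W)) by (apply Rmult_le_pos; nra).
assert (W - A <= r * (1 - A * W)).
{ apply Rsqr_incr_0_var; [exact Q|assumption]. }
nra.
Qed.

(** * Application to the quotient [f z / z] *)

Theorem lemma2 (f : C -> C)
  (f_analytic : forall z : C, Cmod z < 1 -> analytic_at f z)
  (f_lt1 : forall z : C, Cmod z < 1 -> Cmod (f z) < 1)
  (f_0 : f (RtoC 0) = RtoC 0) :
  forall z : C, Cmod z < 1 ->
    Cmod (f z) <=
      Cmod z * ((Cmod z + Cmod (C_derive f (RtoC 0))) /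
                (1 + Cmod (C_derive f (RtoC 0)) * Cmod z)).
Proof.
assert (Hder : forall z, Cmod z < 1 ->
  @is_derive C_AbsRing C_NormedModule f z (C_derive f z)).
{ intros z Hz. apply (C_derive_correct f z z).
  exact (locally_singleton _ _ (f_analytic z Hz)). }
assert (fD : forall z, Cmod z < 1 -> Cdiff f z).
{ intros z Hz. destruct (is_derive_Caratheodory f z _ (Hder z Hz)) as [phi [H1 [_ H2]]].
  exists phi. auto. }
(* The Caratheodory factor of [f] at 0 is the quotient [f z / z], with the value [f' 0] at 0. *)
destruct (is_derive_Caratheodory f 0 _ (Hder 0 ltac:(rewrite Cmod_0; lra))) as [g [gC [g0 gF]]].
assert (fg : forall w, f w = (g w * (w - 0))%C).
{ intros w. rewrite (gF w), f_0. ring. }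
assert (gD : forall z, Cmod z < 1 -> z <> 0 -> Cdiff g z).
{ intros z Hz Hn. apply (Cdiff_quotient f g 0); auto. }
assert (fmod : forall z, Cmod (f z) = Cmod (g z) * Cmod z).
{ intros z. rewrite (fg z), Cmod_mult. do 2 f_equal. ring. }
assert (gB : forall z, Cmod z < 1 -> Cmod (g z) <= 1).
{ intros z Hz. rewrite <- (Rmult_1_r (Cmod (g z))), <- (Rminus_0_r 1) at 1.
  apply (max_modulus_boundary g (RtoC 0 :: nil)); [lra| | | |exact Hz].
  - intros w Hw. destruct (Ceq_dec w 0) as [->|N]; [exact gC|]. apply Cdiff_cont; auto.
  - intros w Hw Hi. apply gD; [exact Hw|]. intros ->. apply Hi. simpl. auto.
  - intros w Hw. rewrite Rminus_0_r, <- fmod. left. auto. }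
intros z Hz. rewrite fmod, Rmult_comm.
apply Rmult_le_compat_l; [apply Cmod_ge_0|]. rewrite <- g0.
assert (Ha := gB 0 ltac:(rewrite Cmod_0; lra)). assert (Hz0 := Cmod_ge_0 z).
(* If [|g 0| = 1], the Moebius map degenerates, but then the bound claimed is 1 and [gB] gives
   it. *)
destruct (Rle_lt_or_eq_dec _ _ Ha) as [H|H].
- apply pseudohyperbolic_bound; auto.
  now apply Schwarz_Pick_continuous_at_0.
- rewrite H. replace ((Cmod z + 1) / (1 + 1 * Cmod z)) with 1 by (field; lra). auto.
Qed.
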